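(* The period-doubling word $\mathbf{d}$ is good.
   Context: The period-doubling word $\mathbf{d}=01000101010001000100010101000101\cdots$ is the one-sided infinite fixed point, beginning with $0$, of the morphism $\delta$ with $\delta(0)=01$, $\delta(1)=00$. A factor of a word is a finite contiguous subword. A word $w$ encounters a pattern $p\in\{0,1\}^*$ if $g(p)$ is a factor of $w$ for some non-erasing morphism $g:\{0,1\}^*\to\{0,1\}^*$ (i.e. $g(0),g(1)$ non-empty). A (finite or one-sided infinite) binary word is good if it contains neither $11$ nor $1001$ as a factor, and encounters neither of the patterns $0000$ and $00010100$. *)

(* Defs.v *)
From mathcomp Require Import all_boot.
Set Implicit Arguments.
Unset Strict Implicit.
Unset Printing Implicit Defensive.

(* Letters are booleans: false is the letter 0, true is the letter 1. *)
Notation letter := bool.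

Declare Scope letter_scope.
Delimit Scope letter_scope with letter.
Notation "0" := false (only parsing) : letter_scope.
Notation "1" := true (only parsing) : letter_scope.

Inductive word :=
  | Finite of seq letter
  | Infinite of (nat -> letter).

Definition factor (u : seq letter) (w : word) : Prop :=
  match w with
  | Finite s => infix u s
  | Infinite x => exists i, u = mkseq (fun j => x (i + j)) (size u)
  end.

(* A morphism of the free monoid {0,1}* is given by its images of letters. *)
Definition morphism := letter -> seq letter.

Definition apply (g : morphism) (u : seq letter) : seq letter :=
  flatten (map g u).

Definition nonerasing (g : morphism) : Prop := forall a, g a <> [::].

Definition encounters (w : word) (p : seq letter) : Prop :=
  exists g : morphism, nonerasing g /\ factor (apply g p) w.

Definition good (w : word) : Prop :=
  [/\ ~ factor [:: 1; 1]%letter w,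
      ~ factor [:: 1; 0; 0; 1]%letter w,
      ~ encounters w [:: 0; 0; 0; 0]%letter
    & ~ encounters w [:: 0; 0; 0; 1; 0; 1; 0; 0]%letter].

(* For a non-erasing g, the infinite word x equals
   g(x) = g(x_0) g(x_1) g(x_2) ... iff the image of every prefix of x is a
   prefix of x. *)
Definition fixed_point (g : morphism) (x : nat -> letter) : Prop :=
  forall n, let u := apply g (mkseq x n) in u = mkseq x (size u).

Definition delta : morphism :=
  fun a => if a then [:: 0; 0]%letter else [:: 0; 1]%letter.

Definition period_doubling (d : nat -> letter) : Prop :=
  d 0 = 0%letter /\ fixed_point delta d.

Lemma size_apply_delta u : size (apply delta u) = (size u).*2.
Proof. by elim: u => //= -[] u IHu; rewrite /apply /= IHu. Qed.

Lemma apply_rcons g u a : apply g (rcons u a) = apply g u ++ g a.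
Proof. by rewrite /apply map_rcons flatten_rcons. Qed.

Lemma fixed_point_deltaP (x : nat -> letter) :
  fixed_point delta x <->
  forall n, x n.*2 = 0%letter /\ x n.*2.+1 = ~~ x n.
Proof.
have mkseqSS n : mkseq x n.+1.*2 =
    mkseq x n.*2 ++ [:: x n.*2; x n.*2.+1].
  by rewrite doubleS !mkseqS -!cats1 -catA.
split=> [fx n | fx n /=].
  have := fx n.+1; have := fx n; rewrite /= !size_apply_delta !size_mkseq.
  rewrite mkseqSS mkseqS apply_rcons => -> /eqP.
  by rewrite eqseq_cat // eqxx /= => /eqP; case: (x n) => -[<- <-].
rewrite size_apply_delta size_mkseq; elim: n => // n IHn.
rewrite mkseqSS mkseqS apply_rcons IHn; have [-> ->] := fx n.
by case: (x n).
Qed.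

Lemma period_doubling_exists : exists d, period_doubling d.
Proof.
exists (fun n => odd (logn 2 n.+1)); split=> //.
apply/fixed_point_deltaP => n; split.
  by rewrite lognE /= dvdn2 /= odd_double.
by rewrite -doubleS -muln2 lognM // addn1.
Qed.

Lemma period_doubling_unique d e :
  period_doubling d -> period_doubling e -> d =1 e.
Proof.
move=> [_ /fixed_point_deltaP fd] [_ /fixed_point_deltaP fe] n.
elim/ltn_ind: n => n IHn; rewrite -(odd_double_half n).
have [d0 d1] := fd n./2; have [e0 e1] := fe n./2.
case: (boolP (odd n)) => on /=; rewrite ?add1n ?add0n; last by rewrite d0 e0.
rewrite d1 e1 IHn // -[X in _ < X]odd_double_half on add1n ltnS.
by rewrite -addnn leq_addr.
Qed.

(* Main.v *)
(* Shifting indices by one, [d] is [n |-> v_2(n) mod 2]: it is [0] at even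
   positions, [1] at positions congruent to 1 mod 4, and keeping only the odd
   positions gives [d] back, complemented.  Hence an occurrence of a pattern
   in which all letters have images of even length halves to a shorter one.
   If some image has odd length, congruences mod 4 force a [1] of [d] to equal
   a letter at an even position. *)
Require Import Defs.
From mathcomp Require Import all_boot.
From mathcomp Require Import zify.

Definition offset (l : letter -> nat) (p : seq letter) (k : nat) : nat :=
  sumn (map l (take k p)).

Lemma nth_apply (g : morphism) (p : seq letter) (k j : nat) (b : letter) :
  k < size p -> j < size (g (nth b p k)) ->
  nth b (apply g p) (offset (size \o g) p k + j) = nth b (g (nth b p k)) j.
Proof.
rewrite /apply /offset; elim: p k => [|a p IHp] [|k] //= k_lt j_lt.
  by rewrite nth_cat j_lt.
by rewrite nth_cat -addnA ltnNge leq_addr /= addKn IHp.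
Qed.

Lemma offset_apply_lt (g : morphism) (p : seq letter) (k j : nat) (b : letter) :
  k < size p -> j < size (g (nth b p k)) ->
  offset (size \o g) p k + j < size (apply g p).
Proof.
rewrite /apply /offset; elim: p k => [|a p IHp] [|k] //= k_lt j_lt.
  by rewrite size_cat ltn_addr.
by rewrite size_cat -addnA ltn_add2l IHp.
Qed.

(* An occurrence of [p] at position [i] of [x], where the images of the
   letters are only known through their lengths [l]. *)
Definition occurs (x : nat -> letter) (p : seq letter) (l : letter -> nat)
    (i : nat) : Prop :=
  forall k1 k2 j, k1 < size p -> k2 < size p ->
    nth false p k1 = nth false p k2 -> j < l (nth false p k1) ->
    x (i + offset l p k1 + j) = x (i + offset l p k2 + j).

Lemma factor_occurs (x : nat -> letter) (g : morphism) (p : seq letter) :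
  factor (apply g p) (Infinite x) -> exists i, occurs x p (size \o g) i.
Proof.
case=> i u_def; exists i => k1 k2 j k1_lt k2_lt pk j_lt.
have nth_x k : k < size p -> j < size (g (nth false p k)) ->
    x (i + offset (size \o g) p k + j) = nth false (g (nth false p k)) j.
  move=> k_lt jk; rewrite -nth_apply // u_def nth_mkseq ?addnA //.
  exact: offset_apply_lt jk.
by rewrite !nth_x -?pk.
Qed.

Section PeriodDoubling.

Variables (d : nat -> letter) (d_pd : period_doubling d).

Lemma pd_even n : d n.*2 = false.
Proof. by have [_ /fixed_point_deltaP/(_ n)[]] := d_pd. Qed.

Lemma pd_odd n : d n.*2.+1 = ~~ d n.
Proof. by have [_ /fixed_point_deltaP/(_ n)[]] := d_pd. Qed.

Lemma pd_neq m n : m %% 4 = 1 -> ~~ odd n -> d m <> d n.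
Proof.
move=> m1 n_even.
have ->: m = (m %/ 4).*2.*2.+1 by lia.
have ->: n = n./2.*2 by lia.
by rewrite pd_odd !pd_even.
Qed.

(** One of [n1], [n2] is odd; it and its shift by 2 cover the residues 1 and 3 mod 4, so a letter 1
    occurs. The other one is even and carries 0. *)
Lemma pd_residues (n1 n2 n3 n4 : nat) :
  odd (n1 + n2) -> n3 = n1 + 2 %[mod 4] -> n4 = n2 + 2 %[mod 4] ->
  d n1 = d n2 -> d n1 = d n3 -> d n1 = d n4 -> False.
Proof.
move=> n12 n3E n4E d12 d13 d14.
have [n1_odd|n1_even] := boolP (odd n1).
  have [n1E|n1E] := eqVneq (n1 %% 4) 1.
    by apply: (@pd_neq n1 n2) => //; lia.
  by apply: (@pd_neq n3 n2); [lia | lia | congruence].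
have [n2E|n2E] := eqVneq (n2 %% 4) 1.
  by apply: (@pd_neq n2 n1) => //; lia.
by apply: (@pd_neq n4 n1) => //; lia.
Qed.

Lemma pd_odd_period n q :
  odd q -> ~ (forall m, m < 4 -> d (n + m) = d (n + m + q)).
Proof.
(* This [m] makes [n + m] congruent to 1 mod 4, hence [n + m + q] even; 5 in place of 1 avoids
   truncated subtraction. *)
move=> q_odd per; pose m := (5 - n %% 4) %% 4.
by apply: (@pd_neq (n + m) (n + m + q)); [lia | lia | apply: per; lia].
Qed.

(** All blocks start at positions of the same parity as [i], so the odd positions of [d] sit alike
    in each; complementing preserves equalities of letters. *)
Lemma occurs_half p (l : letter -> nat) i :
  {in p, forall a, ~~ odd (l a)} -> occurs d p l i ->
  occurs d p (half \o l) i./2.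
Proof.
move=> l_even occ k1 k2 j k1_lt k2_lt pk j_lt.
have offsetE k : offset l p k = (offset (half \o l) p k).*2.
  have: {in take k p, forall a, ~~ odd (l a)} by move=> a /mem_take/l_even.
  rewrite /offset; elim: (take k p) => //= a s IHs s_even.
  rewrite doubleD even_halfK ?s_even ?mem_head // IHs // => b b_s.
  by rewrite s_even // inE b_s orbT.
(* Inside a block the odd positions of [d] have index [2j + 1] if [i] is even and [2j] if [i] is
   odd. *)
have shift k : (i./2 + offset (half \o l) p k + j).*2.+1 =
    i + offset l p k + (j.*2 + ~~ odd i).
  by rewrite offsetE; lia.
apply: negb_inj; rewrite -!pd_odd !shift; apply: occ => //.
have := l_even _ (mem_nth false k1_lt); move: j_lt => /=; lia.
Qed.

(** Descent on [l a0]: halving an even positive length keeps it positive and makes it smaller. *)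
Lemma occurs_descent p a0 : a0 \in p ->
  (forall (l : letter -> nat) i, {in p, forall a, 0 < l a} ->
    (exists2 a, a \in p & odd (l a)) -> ~ occurs d p l i) ->
  ~ encounters (Infinite d) p.
Proof.
move=> a0_p odd_case [g [g_ne /factor_occurs[i]]].
have: {in p, forall a, 0 < (size \o g) a}.
  by move=> a _; rewrite lt0n size_eq0; apply/eqP/g_ne.
move: (size \o g) i => l; have [n] := ubnP (l a0).
elim: n l => // n IHn l l_lt i l_gt0 occ.
have [/hasP a_odd|/hasPn l_even] := boolP (has (odd \o l) p).
  exact: odd_case l_gt0 a_odd occ.
apply: (IHn (half \o l) _ i./2 _ (occurs_half _ _ _ l_even occ)).
  by rewrite /=; have := l_gt0 _ a0_p; lia.
by move=> a a_p /=; have := l_gt0 a a_p; have := l_even a a_p => /=; lia.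
Qed.

Lemma pd_no_11 : ~ factor [:: true; true] (Infinite d).
Proof.
case=> i [/esym d0 /esym d1]; move: d0 d1; rewrite addn0 addn1.
rewrite -(odd_double_half i); case: (odd i); rewrite ?add1n ?add0n.
  by rewrite -doubleS pd_even.
by rewrite pd_even.
Qed.

Lemma pd_no_1001 : ~ factor [:: true; false; false; true] (Infinite d).
Proof.
(* Positions [i] and [i + 3] have opposite parities, and the even one carries 0. *)
case=> i [/esym d0 _ _ /esym d3]; move: d0 d3; rewrite addn0.
rewrite -(odd_double_half i); case: (odd i); rewrite ?add1n ?add0n.
  by rewrite addSnnS -(doubleD _ 2) pd_even.
by rewrite pd_even.
Qed.

Lemma pd_no_0000 :
  ~ encounters (Infinite d) [:: false; false; false; false].
Proof.
apply: (@occurs_descent _ false) => // l i l_gt0 [a].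
rewrite !inE !orbb => /eqP -> l_odd occ.
have l0 : 0 < l false by apply: l_gt0.
(* As [l false] is odd, two blocks advance the position by 2 mod 4. *)
apply: (pd_residues _ _ _ _ _ _ _ (occ 0 1 0 isT isT erefl l0)
  (occ 0 2 0 isT isT erefl l0) (occ 0 3 0 isT isT erefl l0));
  rewrite /offset /=; lia.
Qed.

Lemma pd_no_00010100 : ~ encounters (Infinite d)
  [:: false; false; false; true; false; true; false; false].
Proof.
apply: (@occurs_descent _ false) => // l i l_gt0 [a _ l_odd] occ.
have l0 : 0 < l false by apply: l_gt0.
have l1 : 0 < l true by apply: l_gt0.
have [l01_odd|l01_even] := boolP (odd (l false + l true)).
  (* With x, y the images of 0, 1, the factor xyxyx has odd period |xy|. *)
  apply: (@pd_odd_period (i + (l false).*2) _ l01_odd) => m m_lt.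
  have [m_x|x_m] := ltnP m (l false).
    by have := occ 2 4 m isT isT erefl m_x; rewrite /offset /= => E;
      apply: etrans (etrans E _); congr d; lia.
  have [m_y|y_m] := ltnP (m - l false) (l true).
    by have := occ 3 5 _ isT isT erefl m_y; rewrite /offset /= => E;
      apply: etrans (etrans E _); congr d; lia.
  (* Two positive lengths with odd sum add up to at least 3, so m < 4 <= 2|x| + |y|. *)
  have m_x : m - l false - l true < l false by lia.
  by have := occ 4 6 _ isT isT erefl m_x; rewrite /offset /= => E;
      apply: etrans (etrans E _); congr d; lia.
have l0_odd : odd (l false) by case: a l_odd => //; lia.
(* The initial letters of the first, second, third and last x lie at positions
   of distinct residues mod 4. *)
apply: (pd_residues _ _ _ _ _ _ _ (occ 0 1 0 isT isT erefl l0)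
  (occ 0 2 0 isT isT erefl l0) (occ 0 7 0 isT isT erefl l0));
  rewrite /offset /=; lia.
Qed.

End PeriodDoubling.

Theorem corollary2p6 (d : nat -> letter) (d_pd : period_doubling d) :
  good (Infinite d).
Proof.
split.
- exact: pd_no_11.
- exact: pd_no_1001.
- exact: pd_no_0000.
- exact: pd_no_00010100.
Qed.
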